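(* For every $M > 0$ and $\varepsilon > 0$, there exists a finite collection of arithmetic progressions $A_1, \dots, A_k$ with distinct moduli $d_1,\dots,d_k \ge M$, such that $$\sum_{i=1}^k \frac{1}{d_i} < 1$$ and the density of the uncovered set $R = \mathbb{Z} \setminus \bigcup_{i=1}^k A_i$ is less than $\varepsilon$.
   Context: An arithmetic progression with modulus $d$ is a set of the form $a + d\mathbb{Z}$ with $a \in \mathbb{Z}$, $d \in \mathbb{N}$. The density of the (periodic) set $R$ is the proportion of residue classes modulo $\mathrm{lcm}(d_1,\dots,d_k)$ that it contains. *)

(* Defs.v *)
From mathcomp Require Import all_boot all_order all_algebra.
From mathcomp Require Import boolp classical_sets reals.

Set Implicit Arguments.
Unset Strict Implicit.
Unset Printing Implicit Defensive.

Import Order.TTheory GRing.Theory Num.Theory.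
Local Open Scope classical_set_scope.
Local Open Scope ring_scope.

Definition arith_prog (a : int) (d : nat) : set int :=
  [set x | exists z : int, x = a + d%:Z * z].

Definition uncovered (k : nat) (a : 'I_k -> int) (d : 'I_k -> nat) : set int :=
  ~` (\bigcup_i arith_prog (a i) (d i)).

Definition lcm_moduli (k : nat) (d : 'I_k -> nat) : nat :=
  \big[lcmn/1%N]_(i < k) d i.

(* The proportion of residue classes modulo L contained in S; for L > 0 and S a
   union of residue classes modulo L, this is the natural density of S. *)
Definition density (R : realType) (L : nat) (S : set int) : R :=
  #|[pred r : 'I_L | `[< arith_prog (r : nat)%:Z L `<=` S >]]|%:R / L%:R.

(* Main.v *)
(** Progressions are added in batches. If the current system leaves a set U
    uncovered, periodic modulo Q and of density D, the next batch uses the moduli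
    Q t, Q (t + 1), Q (t + 2), ..., each progression being a residue class inside U
    chosen, by averaging, to cover as much as possible of what is still missing.
    While the uncovered density is at least (1 - eta) D, a progression of modulus d
    covers a new set of density at least (1 - eta) / d, so the divergence of the
    harmonic series eventually brings the density below (1 - eta) D, and iterating
    batches brings it below any eps. At every stage
    (1 - eta) * sum 1/d <= 1 - density, so the sum is less than 1 as long as the
    density stays above eta. *)
Require Import Defs.
From mathcomp Require Import all_boot all_order all_algebra.
From mathcomp Require Import boolp classical_sets reals.
From mathcomp Require Import zify ring lra.

Set Implicit Arguments.
Unset Strict Implicit.
Unset Printing Implicit Defensive.

Import Order.TTheory GRing.Theory Num.Theory.
Local Open Scope ring_scope.

(** * Counting in periodic sets of natural numbers *)

Section Counting.
Local Open Scope nat_scope.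
Implicit Types (U V : pred nat) (L n d c t : nat).

Definition periodic L U := forall x, U (x %% L) = U x.

Definition count_below U n := \sum_(0 <= x < n) U x.

Lemma periodic_dvd L n U : L %| n -> periodic L U -> periodic n U.
Proof. by move=> dvLn pU x; rewrite -pU modn_dvdm // pU. Qed.

Lemma count_below_mul L n U :
  periodic L U -> count_below U (n * L) = n * count_below U L.
Proof.
move=> pU; rewrite /count_below big_nat_mul.
rewrite (eq_bigr (fun=> \sum_(0 <= x < L) U x)); first by rewrite sum_nat_const_nat subn0.
move=> i _; rewrite -{1}[i * L]add0n big_addn mulSn addnK.
by apply: eq_bigr => x _; rewrite -pU addnC modnMDl pU.
Qed.

Lemma count_below_residue d c n :
  c < d -> count_below (fun x => x %% d == c) (n * d) = n.
Proof.
move=> ltcd; rewrite count_below_mul; last by move=> x; rewrite modn_mod.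
rewrite /count_below big_mkord (bigD1 (Ordinal ltcd)) //= modn_small // eqxx.
rewrite big1 ?addn0 ?muln1 // => i; rewrite -val_eqE /= => /negPf.
by rewrite modn_small // => ->.
Qed.

Lemma count_below_gt0 U n : 0 < count_below U n -> exists2 x, x < n & U x.
Proof.
rewrite /count_below big_mkord; case: (pickP (fun i : 'I_n => U i)) => [i Ui _|U0].
  by exists i.
by rewrite big1 // => i _; rewrite U0.
Qed.

(* Averaging over the residue classes modulo d that lie in V. *)
Lemma exists_rich_class U V d n :
    0 < count_below V d -> periodic d V -> (forall x, U x -> V x) ->
  exists2 c, c < d & count_below U n <=
    count_below V d * count_below (fun x => U x && (x %% d == c)) n.
Proof.
move=> Vgt0 pV UV; have [c0 ltc0 Vc0] := count_below_gt0 Vgt0.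
pose f (c : 'I_d) := count_below (fun x => U x && (x %% d == c)) n.
have [c Vc maxc] := @arg_maxnP _ (Ordinal ltc0) (fun c : 'I_d => V c) f Vc0.
exists (val c); first exact: ltn_ord.
have d_gt0 : 0 < d by apply: leq_ltn_trans ltc0.
(* Since [U] lies inside the [d]-periodic [V], the classes contained in [V] account for all of
   [U]. *)
have -> : count_below U n = \sum_(i < d | V i) f i.
  rewrite /f /count_below exchange_big /=; apply: eq_bigr => x _.
  case Ux: (U x) => /=; last by rewrite big1.
  have ltx : x %% d < d by rewrite ltn_mod.
  rewrite (bigD1 (Ordinal ltx)) /=; last by rewrite pV UV.
  rewrite eqxx big1 // => i /andP[_]; rewrite -val_eqE /= => /negPf.
  by rewrite eq_sym => ->.
have -> : count_below V d = \sum_(i < d | V i) 1.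
  by rewrite /count_below big_mkord [RHS]big_mkcond; apply: eq_bigr => i _; case: (V i).
by rewrite big_distrl /=; apply: leq_sum => i Vi; rewrite mul1n; apply: maxc.
Qed.

End Counting.

(* A finite system of arithmetic progressions a + d Z is a list of pairs (a, d). *)
Definition modulus_prod (s : seq (nat * nat)) : nat := \prod_(p <- s) p.2.

Definition missed (s : seq (nat * nat)) : pred nat :=
  fun x => all (fun p => x != p.1 %[mod p.2]) s.

Lemma dvdn_modulus_prod s p : p \in s -> (p.2 %| modulus_prod s)%N.
Proof.
by move=> ps; rewrite /modulus_prod (big_rem p) //= dvdn_mulr.
Qed.

Lemma periodic_missed s L :
  (forall p, p \in s -> (p.2 %| L)%N) -> periodic L (missed s).
Proof.
move=> dvs x; rewrite /missed; apply: eq_in_all => p /dvs dvp.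
by rewrite modn_dvdm.
Qed.

(** * Density left uncovered by a finite system *)

Section Density.
Variable R : realFieldType.
Implicit Types (s : seq (nat * nat)).

Definition miss_density s : R :=
  (count_below (missed s) (modulus_prod s))%:R / (modulus_prod s)%:R.

Definition mass s : R := \sum_(p <- s) p.2%:R^-1.

Lemma modulus_prod_gt0 s : all (fun p => 0 < p.2)%N s -> (0 < modulus_prod s)%N.
Proof.
by move=> /allP s_gt0; rewrite /modulus_prod big_seq; apply: prodn_cond_gt0 => p /s_gt0.
Qed.

(** Every common multiple of the moduli is a period of the missed set, so both counts agree once
    extended to the product of the two periods. This lets different systems be compared over one
    period, and later the product be replaced by the lcm. *)
Lemma miss_densityE s L : (0 < L)%N -> (forall p, p \in s -> (p.2 %| L)%N) ->
  miss_density s = (count_below (missed s) L)%:R / L%:R.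
Proof.
move=> L_gt0 dvs.
have P_gt0 : (0 < modulus_prod s)%N.
  apply: modulus_prod_gt0; apply/allP => p /dvs; exact: dvdn_gt0.
have E : (L * count_below (missed s) (modulus_prod s) =
          modulus_prod s * count_below (missed s) L)%N.
  rewrite -!count_below_mul 1?mulnC //; first exact: periodic_missed.
  exact: periodic_missed (@dvdn_modulus_prod s).
apply/eqP; rewrite /miss_density eqr_div ?pnatr_eq0 -?lt0n // -!natrM.
by rewrite mulnC E mulnC.
Qed.

(* An ideal progression would cover 1 / d; choosing it inside the uncovered set
   of the earlier system s0 loses only the ratio of the two densities. *)
Lemma extend_system s0 s d :
    (0 < d)%N -> all (fun p => 0 < p.2)%N s ->
    (forall p, p \in s0 -> (p.2 %| d)%N) ->
    (forall x, missed s x -> missed s0 x) -> 0 < miss_density s0 ->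
  exists a,
    miss_density s - d%:R^-1 <= miss_density ((a, d) :: s) /\
    miss_density ((a, d) :: s) <=
      miss_density s - miss_density s / miss_density s0 / d%:R.
Proof.
move=> d_gt0 s_gt0 dvs0 sub dens_gt0.
set P := modulus_prod s; have P_gt0 : (0 < P)%N := modulus_prod_gt0 s_gt0.
pose L := (P * d)%N; have L_gt0 : (0 < L)%N by rewrite muln_gt0 P_gt0.
have dvsL p : p \in s -> (p.2 %| L)%N.
  by move=> ps; rewrite dvdn_mulr // dvdn_modulus_prod.
have V_gt0 : (0 < count_below (missed s0) d)%N.
  rewrite lt0n; apply: contraTneq dens_gt0 => V0.
  by rewrite (miss_densityE d_gt0 dvs0) V0 mul0r ltxx.
have [c ltcd rich] :=
  exists_rich_class L V_gt0 (periodic_missed dvs0) sub.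
exists c; set g := count_below (fun x => _ && _) L in rich *.
(* The class of [c] has exactly [P] members below [L], so the density drops by at most
   [P / L = 1 / d]. *)
have gP : (g <= P)%N.
  rewrite -(count_below_residue P ltcd); apply: leq_sum => x _.
  by case: (missed s x).
have split_s : (count_below (missed s) L = g + count_below (missed ((c, d) :: s)) L)%N.
  rewrite /g /count_below -big_split /=; apply: eq_bigr => x _.
  rewrite /missed /= [(c %% d)%N]modn_small //.
  by case: all; case: eqP.
have LR : (0 : R) < L%:R by rewrite ltr0n.
have dR : (0 : R) < d%:R by rewrite ltr0n.
have PR : (0 : R) < P%:R by rewrite ltr0n.
rewrite (@miss_densityE ((c, d) :: s) L) //; last first.
  by move=> p; rewrite inE => /orP[/eqP ->|/dvsL //]; rewrite /= dvdn_mull.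
rewrite (miss_densityE d_gt0 dvs0) (miss_densityE L_gt0 dvsL).
set v := count_below _ d in V_gt0 rich *.
set u := count_below (missed s) L in rich split_s *; set u' := count_below (missed _) L in split_s *.
have vR : (0 : R) < v%:R by rewrite ltr0n.
have uE : u%:R = g%:R + u'%:R :> R by rewrite split_s natrD.
have richR : u%:R <= v%:R * g%:R :> R by rewrite -natrM ler_nat.
have gPR : g%:R <= P%:R :> R by rewrite ler_nat.
split.
  have -> : d%:R^-1 = P%:R / L%:R :> R by rewrite natrM; field; rewrite !lt0r_neq0.
  by rewrite lerBlDr -mulrDl ler_pM2r ?invr_gt0 // uE; lra.
rewrite lerBrDr.
have -> : u%:R / L%:R / (v%:R / d%:R) / d%:R = u%:R / v%:R / L%:R :> R.
  by field; rewrite !lt0r_neq0.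
rewrite -mulrDl ler_pM2r ?invr_gt0 // uE addrC lerD2r -uE.
by rewrite ler_pdivrMr // mulrC.
Qed.

End Density.

(** * One batch of progressions *)

Section Batches.
Variable R : realFieldType.
Implicit Types (s : seq (nat * nat)) (m n t : nat) (eta : R).

(** The third clause is the efficiency invariant; the fourth turns it into
    [(1 - eta) * mass R s < 1 - eta], which forces the mass below 1 when [eta < 1]. *)
Definition admissible m eta s : Prop :=
  [/\ uniq (unzip2 s), all (fun p => m <= p.2)%N s,
      (1 - eta) * mass R s <= 1 - miss_density R s & eta < miss_density R s].

(* A single new progression lowers the density by at most 1 / m, so the gap
   hypothesis keeps the density above eta even when a step passes below
   (1 - eta) times the initial density. *)
Lemma batch m eta s0 t n :
    (0 < m)%N -> 0 < eta < 1 -> admissible m eta s0 ->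
    eta + m%:R^-1 < (1 - eta) * miss_density R s0 ->
    all (fun p => p.2 < t)%N s0 -> (m <= t)%N ->
  exists s, admissible m eta s /\
   (miss_density R s <= (1 - eta) * miss_density R s0 \/
    [/\ all (fun p => p.2 < modulus_prod s0 * (t + n))%N s,
        forall x, missed s x -> missed s0 x,
        (1 - eta) * miss_density R s0 < miss_density R s &
        miss_density R s <= miss_density R s0 -
          (1 - eta) / (modulus_prod s0)%:R * \sum_(i < n) (t + i)%:R^-1]).
Proof.
move=> m_gt0 /andP[eta_gt0 eta_lt1] adm0 gap s0_lt le_mt.
have pos s' : admissible m eta s' -> all (fun p => 0 < p.2)%N s'.
  by case=> _ /allP H _ _; apply/allP => p /H; apply: leq_trans.
have Q_gt0 : (0 < modulus_prod s0)%N by apply/modulus_prod_gt0/pos.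
have D_gt0 : 0 < miss_density R s0 by case: adm0 => _ _ _; apply: lt_trans.
set Q := modulus_prod s0 in Q_gt0 *; set D := miss_density R s0 in gap D_gt0 *.
elim: n => [|n [s [adm [small|[s_lt sub big_s dens_s]]]]].
- exists s0; split=> //; right; split=> //.
  + apply/allP => p /(allP s0_lt) ltp; rewrite addn0.
    by apply: leq_trans ltp _; rewrite leq_pmull.
  + by rewrite -/D gtr_pMl // gtrBl.
  + by rewrite big_ord0 mulr0 subr0.
- by exists s; split=> //; left.
(* The factor [Q] makes [d] a multiple of every modulus of [s0], so whole classes modulo [d] lie in
   its uncovered set; by [s_lt], [d] also exceeds all moduli used so far. *)
set d := (Q * (t + n))%N.
have t_gt0 : (0 < t + n)%N by rewrite addn_gt0 (leq_trans m_gt0 le_mt).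
have d_gt0 : (0 < d)%N by rewrite muln_gt0 Q_gt0.
have le_md : (m <= d)%N.
  by rewrite (leq_trans le_mt) // (leq_trans (leq_addr n t)) // leq_pmull.
have dvs0 p : p \in s0 -> (p.2 %| d)%N.
  by move=> ps; rewrite dvdn_mulr // dvdn_modulus_prod.
have [a [lb ub]] := extend_system d_gt0 (pos _ adm) dvs0 sub D_gt0.
set s' := (a, d) :: s in lb ub.
have dR : (0 : R) < d%:R by rewrite ltr0n.
have ub' : miss_density R s' <= miss_density R s - (1 - eta) / d%:R.
  apply: le_trans ub _; rewrite lerD2l lerN2 ler_pM2r ?invr_gt0 //.
  by rewrite ler_pdivlMr // ltW.
have le_dm : (d%:R : R)^-1 <= m%:R^-1.
  by rewrite lef_pV2 ?posrE ?ltr0n // ler_nat.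
(* The drop in [ub'] pays for the extra mass [1 / d]; [lb], [le_dm], [big_s] and [gap] keep the
   density above [eta]. *)
have adm' : admissible m eta s'.
  case: adm => uniq_s le_s mass_s _; split.
  - rewrite /= uniq_s andbT; apply/mapP => -[p /(allP s_lt)].
    by move=> /[swap] <-; rewrite ltnn.
  - by rewrite /= le_md.
  - by rewrite /mass big_cons -/(mass R s) mulrDr; lra.
  - by rewrite -/D in big_s; lra.
exists s'; split=> //.
have [le_s'|gt_s'] := lerP (miss_density R s') ((1 - eta) * D); [by left|right].
split=> //.
- have ltd : (d < Q * (t + n.+1))%N by rewrite addnS ltn_pmul2l.
  by rewrite /= ltd; apply/allP => p /(allP s_lt) ltp; apply: ltn_trans ltp ltd.
- by move=> x /andP[_ /sub].
apply: le_trans ub' _; rewrite big_ord_recr /= mulrDr opprD addrA lerD //.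
by rewrite /d natrM invfM mulrA.
Qed.

End Batches.

(** * Harmonic divergence and iteration of batches *)

Section Iteration.
Variable R : archiRealFieldType.
Implicit Types (s : seq (nat * nat)) (m n t : nat) (eta eps : R).

Lemma nat_above (x : R) : exists n : nat, x < n%:R.
Proof.
exists (Num.bound `|x|); apply: le_lt_trans (ler_norm x) _.
exact: archi_boundP.
Qed.

(** Oresme's doubling: extending the range from [t + n] to [2 * (t + n)] adds [t + n] terms, each at
    least [1 / (2 * (t + n))], hence at least [1 / 2] in total. *)
Lemma harmonic_tail_unbounded t (B : R) :
  (0 < t)%N -> exists n, B < \sum_(i < n) (t + i)%:R^-1.
Proof.
move=> t_gt0; have [k ltBk] := nat_above (B * 2).
suff [n le_kn] : exists n, k%:R / 2 <= \sum_(i < n) (t + i)%:R^-1 :> R.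
  by exists n; apply: lt_le_trans le_kn; rewrite ltr_pdivlMr.
elim: k {ltBk} => [|k [n le_kn]]; first by exists 0%N; rewrite big_ord0 mul0r.
exists (n + (t + n))%N; rewrite big_split_ord /= -natr1 mulrDl lerD //.
have -> : 1 / 2 = \sum_(i < t + n) ((2 * (t + n))%:R : R)^-1.
  rewrite sumr_const card_ord -[RHS]mulr_natr natrM; field.
  by rewrite -natrD pnatr_eq0 -lt0n addn_gt0 t_gt0.
apply: ler_sum => i _; rewrite lef_pV2 ?posrE ?ltr0n ?muln_gt0 ?addn_gt0 ?t_gt0 //.
by rewrite ler_nat; have := ltn_ord i; lia.
Qed.

(** If the threshold were never reached, a long enough batch would make the density nonpositive,
    against admissibility. *)
Lemma shrink_density m eta s0 :
    (0 < m)%N -> 0 < eta < 1 -> admissible m eta s0 ->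
    eta + m%:R^-1 < (1 - eta) * miss_density R s0 ->
  exists s, admissible m eta s /\ miss_density R s <= (1 - eta) * miss_density R s0.
Proof.
move=> m_gt0 eta01 adm gap; have /andP[eta_gt0 eta_lt1] := eta01.
pose t := (m + \sum_(p <- s0) p.2.+1)%N.
have t_gt0 : (0 < t)%N by rewrite addn_gt0 m_gt0.
have s0_lt : all (fun p => p.2 < t)%N s0.
  by apply/allP => p ps; rewrite /t (big_rem p) //=; lia.
have Q_gt0 : (0 < modulus_prod s0)%N.
  apply/modulus_prod_gt0/allP => p; case: adm => _ /allP le_m _ _ /le_m.
  exact: leq_trans.
set Q := modulus_prod s0 in Q_gt0.
have QR : (0 : R) < Q%:R by rewrite ltr0n.
(* With this bound, [(1 - eta) / Q] times the harmonic sum exceeds the initial density. *)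
have [n ltn] := harmonic_tail_unbounded (miss_density R s0 * Q%:R / (1 - eta)) t_gt0.
have [s [adm_s [small|[_ _ big_s dens_s]]]] :=
  batch n m_gt0 eta01 adm gap s0_lt (leq_addr _ _).
  by exists s.
exfalso; have : 0 < miss_density R s by case: adm_s => _ _ _; apply: lt_trans.
apply/negP; rewrite -leNgt (le_trans dens_s) // subr_le0 -/Q.
have e1 : 0 < 1 - eta by rewrite subr_gt0.
by rewrite mulrC mulrA ler_pdivlMr // -ler_pdivrMr // ltW.
Qed.

(** While the density is at least [eps], the gap condition persists and each batch lowers the
    density by at least [eta * eps], so finitely many batches suffice. *)
Lemma exists_small_density m eta eps :
    (0 < m)%N -> 0 < eta < 1 -> 0 < eps ->
    eta + m%:R^-1 < (1 - eta) * eps ->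
  exists s, admissible m eta s /\ miss_density R s < eps.
Proof.
move=> m_gt0 eta01 eps_gt0 gap; have /andP[eta_gt0 eta_lt1] := eta01.
have step n : exists s, admissible m eta s /\
    (miss_density R s < eps \/ miss_density R s <= 1 - n%:R * (eta * eps)).
  elim: n => [|n [s [adm [lts|les]]]].
  - have dens_nil : miss_density R [::] = 1.
      by rewrite /miss_density /modulus_prod big_nil /count_below big_nat1 divr1.
    exists [::]; split; last by right; rewrite dens_nil mul0r subr0.
    by split; rewrite // ?dens_nil // /mass big_nil mulr0 subrr.
  - by exists s; split=> //; left.
  have [lts|ges] := ltP (miss_density R s) eps; first by exists s; split=> //; left.
  have gap' : eta + m%:R^-1 < (1 - eta) * miss_density R s.
    by apply: lt_le_trans gap _; rewrite ler_wpM2l // subr_ge0 ltW.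
  have [s' [adm' les']] := shrink_density m_gt0 eta01 adm gap'.
  exists s'; split=> //; right; rewrite -natr1.
  have : eta * eps <= eta * miss_density R s by rewrite ler_wpM2l // ltW.
  by lra.
have [n ltn] := nat_above (eta * eps)^-1.
have [s [adm [lts|les]]] := step n; first by exists s.
exfalso; have : 0 < miss_density R s by case: adm => _ _ _; apply: lt_trans.
apply/negP; rewrite -leNgt (le_trans les) // subr_le0.
by rewrite -ler_pdivrMr ?mulr_gt0 // mul1r ltW.
Qed.

Lemma exists_efficient_system m0 eps : 0 < eps ->
  exists s, [/\ uniq (unzip2 s), all (fun p => maxn m0 1 <= p.2)%N s,
                mass R s < 1 & miss_density R s < eps].
Proof.
move=> eps_gt0; pose e := Num.min eps 1.
have e_gt0 : 0 < e by rewrite lt_min eps_gt0 ltr01.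
have e_le1 : e <= 1 by rewrite ge_min lexx orbT.
have e_le : e <= eps by rewrite ge_min lexx.
have [m1 ltm1] := nat_above (4 / e).
(* These choices give [eta + 1 / m < e / 2], while [(1 - eta) * e >= 3 * e / 4] because [e <= 1]. *)
pose m := maxn m1 (maxn m0 1); pose eta := e / 4.
have m_gt0 : (0 < m)%N by rewrite /m; lia.
have mR : m%:R^-1 < e / 4.
  rewrite -[e / 4]invrK ltf_pV2 ?posrE ?invr_gt0 ?divr_gt0 ?ltr0n //.
  by rewrite invf_div (lt_le_trans ltm1) // ler_nat leq_maxl.
have eta01 : 0 < eta < 1 by rewrite /eta; apply/andP; split; lra.
have gap : eta + m%:R^-1 < (1 - eta) * e.
  have : e * e <= e by rewrite ger_pMr.
  by rewrite /eta; lra.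
have [s [[uniq_s le_s mass_s dens_s] lts]] :=
  exists_small_density m_gt0 eta01 e_gt0 gap.
exists s; split=> //.
- by apply/allP => p /(allP le_s); apply: leq_trans; rewrite leq_maxr.
- have /andP[_ eta_lt1] := eta01.
  have e1 : 0 < 1 - eta by rewrite subr_gt0.
  by rewrite -(ltr_pM2l e1) mulr1 (le_lt_trans mass_s) // ltrD2l ltrN2.
- exact: lt_le_trans e_le.
Qed.

End Iteration.

(** * Transfer to progressions of integers and the lcm of the moduli *)

Lemma arith_prog_nat (a d x : nat) :
  x = a %[mod d] -> arith_prog a%:Z d x%:Z.
Proof.
move=> eq_xa; have /dvdzP[z xa] : (d%:Z %| x%:Z - a%:Z)%Z.
  by rewrite -eqz_mod_dvd !modz_nat eq_xa.
by exists z; rewrite mulrC -xa addrC subrK.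
Qed.

Theorem theorem10p1 (R : realType) (M eps : R) (hM : 0 < M) (heps : 0 < eps) :
  exists (k : nat) (a : 'I_k -> int) (d : 'I_k -> nat),
    [/\ injective d,
        forall i : 'I_k, M <= (d i)%:R,
        \sum_(i < k) (d i)%:R^-1 < 1 :> R
      & density R (lcm_moduli d) (uncovered a d) < eps].
Proof.
have [m0 ltm0] := nat_above M.
have [s [uniq_s /allP le_s mass_s dens_s]] := exists_efficient_system m0 heps.
pose p i := nth (0, 0)%N s i; pose d (i : 'I_(size s)) := (p i).2.
have ps (i : 'I_(size s)) : p i \in s by apply: mem_nth.
exists (size s), (fun i => (p i).1%:Z), d; split.
- move=> i j eq_ij; apply: val_inj; apply/eqP => /=.
  rewrite -(nth_uniq 0%N _ _ uniq_s) ?size_map ?ltn_ord //.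
  by rewrite !(nth_map (0, 0)%N) ?ltn_ord //; apply/eqP.
- move=> i; apply: le_trans (ltW ltm0) _; rewrite ler_nat.
  by have := le_s _ (ps i); rewrite geq_max => /andP[].
- by move: mass_s; rewrite /mass (big_nth (0, 0)%N) big_mkord.
have dvL q : q \in s -> (q.2 %| lcm_moduli d)%N.
  move=> /(nthP (0, 0)%N)[i lti <-].
  exact: (biglcmn_sup (Ordinal lti)).
have L_gt0 : (0 < lcm_moduli d)%N.
  rewrite /lcm_moduli; elim/big_ind: _ => // [x y x_gt0 y_gt0|i _].
    by rewrite lcmn_gt0 x_gt0.
  by have := le_s _ (ps i); rewrite geq_max => /andP[].
apply: le_lt_trans dens_s; rewrite (miss_densityE R L_gt0 dvL).
rewrite /density ler_pM2r ?invr_gt0 ?ltr0n // ler_nat.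
rewrite /count_below big_mkord -sum1_card [leqLHS]big_mkcond /=.
(* An inequality of counts suffices: a residue [r] whose whole class is uncovered is itself missed
   by [s]. *)
apply: leq_sum => r _; rewrite inE; case: asboolP => // sub.
rewrite lt0b; apply/allP => q /(nthP (0, 0)%N)[i lti <-].
apply/eqP => eq_r; have /sub : arith_prog (r : nat)%:Z (lcm_moduli d) (r : nat)%:Z.
  exact: arith_prog_nat.
by apply; exists (Ordinal lti) => //; apply: arith_prog_nat.
Qed.
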